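(* Let $P=\{x\in\mathbb{R}^d : a^i\cdot x\le b_i,\ 1\le i\le m\}$ be a $d$-dimensional polyhedron, where the representation is irredundant, and let $\mathfrak{p}_1,\dots,\mathfrak{p}_l\in\mathbb{R}[x_1,\dots,x_d]$ be such that $$P=\{x\in\mathbb{R}^d : \mathfrak{p}_1(x)\ge 0,\dots,\mathfrak{p}_l(x)\ge 0\}.$$ (i) For each $i\in\{1,\dots,m\}$, the facet-defining linear polynomial $b_i-a^i\cdot x$ is a factor of one of the polynomials $\mathfrak{p}_j$. (ii) Let $F$ be a $k$-dimensional face of $P$. Then there exist $d-k$ of the polynomials, $\mathfrak{p}_{j_1},\dots,\mathfrak{p}_{j_{d-k}}$ (with pairwise distinct indices $j_1,\dots,j_{d-k}\in\{1,\dots,l\}$), which vanish on the affine hull $\mathrm{aff}\,F$ of $F$, i.e. $$\mathrm{aff}\,F\subset\{x\in\mathbb{R}^d : \mathfrak{p}_{j_1}(x)=\cdots=\mathfrak{p}_{j_{d-k}}(x)=0\}.$$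
   Context: A polyhedron is an intersection of finitely many closed halfspaces of $\mathbb{R}^d$; $a\cdot x$ denotes the standard inner product, $a^i\in\mathbb{R}^d$, $b_i\in\mathbb{R}$. The representation of $P$ is called irredundant if $P\cap\{x\in\mathbb{R}^d : a^i\cdot x=b_i\}$ is a facet (a $(d-1)$-dimensional face) of $P$ for each $1\le i\le m$, with distinct $i$ giving distinct facets. *)

(* Defs.v *)
From mathcomp Require Import all_boot all_order all_algebra.
From mathcomp Require Import classical_sets reals.
From mathcomp Require Import mpoly.

Set Implicit Arguments.
Unset Strict Implicit.
Unset Printing Implicit Defensive.

Import Order.TTheory GRing.Theory Num.Theory.

Local Open Scope classical_set_scope.
Local Open Scope ring_scope.

Section Polyhedra.

Variables (R : realType) (d : nat).
Implicit Types (S P F : set 'rV[R]_d) (a x : 'rV[R]_d) (p q : {mpoly R[d]}).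

Definition dot a x : R := \sum_(k < d) a 0 k * x 0 k.

Definition polyhedron m (a : 'I_m -> 'rV[R]_d) (b : 'I_m -> R) :
  set 'rV[R]_d := [set x | forall i, dot (a i) x <= b i].

Definition aff_hull S : set 'rV[R]_d :=
  [set x | exists n (c : 'I_n -> R) (v : 'I_n -> 'rV[R]_d),
     [/\ forall s, S (v s), \sum_s c s = 1 & x = \sum_s c s *: v s]].

(* The affine hull of S is a translate of a k-dimensional linear subspace;
   the empty set has no dimension in this sense. *)
Definition has_dim S (k : nat) : Prop :=
  exists (x0 : 'rV[R]_d) (U : {vspace 'rV[R]_d}),
    \dim U = k /\ aff_hull S = [set x | x - x0 \in U].

(* c = 0 is allowed, so P itself and the empty set are (improper) faces. *)
Definition is_face P F : Prop :=
  exists (c : 'rV[R]_d) (delta : R),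
    (forall x, P x -> dot c x <= delta) /\
    F = P `&` [set x | dot c x = delta].

(* Stated with k.+1 = d, since the truncated d.-1 would be wrong for d = 0. *)
Definition is_facet P F : Prop :=
  is_face P F /\ exists2 k, k.+1 = d & has_dim F k.

Definition irredundant m (a : 'I_m -> 'rV[R]_d) (b : 'I_m -> R) : Prop :=
  let facet i := polyhedron a b `&` [set x | dot (a i) x = b i] in
  (forall i, is_facet (polyhedron a b) (facet i)) /\ injective facet.

Definition peval p x : R := p.@[fun k => x 0 k].

Definition facet_poly a (beta : R) : {mpoly R[d]} :=
  beta%:MP - \sum_(k < d) a 0 k *: 'X_k.

Definition is_factor q p : Prop := exists r, p = q * r.

End Polyhedra.

(* Main.v *)
Require Import Defs.
From mathcomp Require Import all_boot all_order all_algebra.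
From mathcomp Require Import boolp classical_sets reals.
From mathcomp Require Import mpoly zify ring lra.

(** For a point [v] of [P], let [active v] be the set of constraints that are
    tight at [v], and let the flat of [v] be the affine subspace which they
    define; for [v] in the relative interior of a face this is the affine hull
    of the face ([face_flat]). Both parts follow from one observation
    ([new_vanishing]): if [active w] is a proper subset of [active v] for points
    [v] and [w] of [P], then the flat of [v] lies in that of [w], and some [p_j]
    vanishes identically on the flat of [v] but not on the flat of [w].
    Otherwise, the [p_j] that do not vanish on the flat of [w] would all be
    positive at some point of [P] in the flat of [v]. They would remain positive
    after a small step within the flat of [w], whereas the other [p_j] are zero
    there; so [P] would contain a neighbourhood of this point in the flat of
    [w], although the point lies on the boundary of a constraint that is not
    constant on this flat.

    For (i), take [v] in the relative interior of the facet and [w] in the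
    interior of [P]. Some [p_j] vanishes on the flat of [v], which is the whole
    hyperplane [a_i . x = b_i], and is therefore divisible by
    [b_i - a_i . x] ([factor_of_hyperplane]).

    For (ii), a face of dimension [k < d] lies in a face with fewer active
    constraints and dimension at most [k + 1] ([next_face]). Passing to the
    smaller face gains at least one vanishing polynomial, so at least [d - k] of
    them vanish on the affine hull of a [k]-dimensional face
    ([card_vanishing]). *)

Set Implicit Arguments.
Unset Strict Implicit.
Unset Printing Implicit Defensive.

Import Order.TTheory GRing.Theory Num.Theory.

Local Open Scope classical_set_scope.
Local Open Scope ring_scope.

(** * Properties of small positive parameters *)

Section SmallParameters.

Variable R : realFieldType.
Implicit Types (Q : R -> Prop) (f : {poly R}).

(** [Q t] holds for all small enough [t > 0]. *)
Definition for_small Q := exists2 e : R, 0 < e & forall t, 0 < t < e -> Q t.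

Lemma for_small_and Q1 Q2 :
  for_small Q1 -> for_small Q2 -> for_small (fun t => Q1 t /\ Q2 t).
Proof.
move=> [e e0 He] [e' e'0 He']; exists (Num.min e e').
  by rewrite lt_min e0.
move=> t /andP[t0]; rewrite lt_min => /andP[te te'].
by split; [apply: He | apply: He']; rewrite t0.
Qed.

Lemma for_small_seq (I : eqType) (s : seq I) (Q : I -> R -> Prop) :
  (forall i, i \in s -> for_small (Q i)) ->
  for_small (fun t => forall i, i \in s -> Q i t).
Proof.
elim: s => [|i s IHs] Qs; first by exists 1.
have [|e e0 He] := for_small_and (Qs i (mem_head i s)) (IHs _).
  by move=> j js; apply: Qs; rewrite inE js orbT.
exists e => // t /He[Qi Qs'] j; rewrite inE => /predU1P[->//|]; exact: Qs'.
Qed.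

Lemma for_small_all (I : finType) (Q : I -> R -> Prop) :
  (forall i, for_small (Q i)) -> for_small (fun t => forall i, Q i t).
Proof.
move=> Qs; have [e e0 He] := @for_small_seq I (enum I) Q (fun i _ => Qs i).
by exists e => // t /He Qt i; apply: Qt; rewrite mem_enum.
Qed.

Lemma for_small_ex Q : for_small Q -> exists2 t, 0 < t & Q t.
Proof.
move=> [e e0 He]; exists (e / 2); first by rewrite divr_gt0.
by apply: He; lra.
Qed.

Lemma poly_bounded_itv01 f :
  exists M, forall t, 0 <= t <= 1 -> `|f.[t]| <= M.
Proof.
elim/poly_ind: f => [|f c [M HM]].
  by exists 0 => t _; rewrite horner0 normr0.
exists (M + `|c|) => t t01; rewrite hornerMXaddC.
apply: (le_trans (ler_normD _ _)); rewrite lerD2r normrM.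
have [t0 t1] := andP t01.
by rewrite (ger0_norm t0); apply: (le_trans _ (HM t t01)); rewrite ler_piMr.
Qed.

Lemma poly_gt0_small f : 0 < f.[0] -> for_small (fun t => 0 < f.[t]).
Proof.
elim/poly_ind: f => [|f c _]; first by rewrite horner0 ltxx.
rewrite hornerMXaddC mulr0 add0r => c0.
have [M HM] := poly_bounded_itv01 f.
have M0 : 0 <= M by apply: le_trans (HM 0 _); rewrite // lexx ler01.
exists (Num.min 1 (c / (M + 1))).
  by rewrite lt_min ltr01 divr_gt0 // ltr_wpDl.
move=> t /andP[t0]; rewrite lt_min ltr_pdivlMr ?ltr_wpDl // => /andP[t1 tM].
rewrite hornerMXaddC; have := HM t; rewrite (ltW t0) (ltW t1) ler_norml.
by move=> /(_ isT)/andP[fM _]; nra.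
Qed.

(** If [f.[0] != 0] the square of [f] is positive near 0; otherwise the factor
    ['X] of [f], which is nonzero for [t > 0], can be cancelled. *)
Lemma poly_neq0_small f : f != 0 -> for_small (fun t => f.[t] != 0).
Proof.
elim/poly_ind: f => [|f c IHf fc0]; first by rewrite eqxx.
have [c0|c0] := eqVneq c 0; last first.
  have [|e e0 He] := @poly_gt0_small ((f * 'X + c%:P) ^+ 2).
    rewrite horner_exp hornerMXaddC mulr0 add0r.
    by rewrite lt_def sqrf_eq0 c0 sqr_ge0.
  exists e => // t /He; rewrite horner_exp lt_def sqrf_eq0.
  by case/andP.
have [|e e0 He] := IHf.
  by apply: contraNneq fc0 => ->; rewrite c0 mul0r add0r.
exists e => // t te; rewrite hornerMXaddC c0 addr0 mulf_neq0 ?He//.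
by case/andP: te => /gt_eqF->.
Qed.

Lemma poly_eq0_fun f : (forall t, f.[t] = 0) -> f = 0.
Proof.
move=> f0; apply/eqP; apply/negPn/negP => /poly_neq0_small/for_small_ex[t _].
by rewrite f0 eqxx.
Qed.

End SmallParameters.

(** * Polynomials and the functions they define *)

(** Uniqueness of the digits in base [B]. *)
Lemma nadic_inj (B d : nat) (u v : 'I_d -> nat) :
  (forall k, (u k < B)%N) -> (forall k, (v k < B)%N) ->
  (\sum_k u k * B ^ k = \sum_k v k * B ^ k)%N -> u =1 v.
Proof.
elim: d u v => [|d IHd] u v uB vB; first by move=> _ [].
have split_sum w : (\sum_(k < d.+1) w k * B ^ k =
    (\sum_(k < d) w (lift ord0 k) * B ^ k) * B + w ord0)%N.
  rewrite big_ord_recl expn0 muln1 addnC big_distrl /=; congr (_ + _)%N.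
  by apply: eq_bigr => k _; rewrite /bump /= add1n expnSr mulnA.
have B0 : (0 < B)%N by apply: leq_ltn_trans (uB ord0).
rewrite !split_sum => E.
have u0v0 : u ord0 = v ord0.
  by have := congr1 (modn^~ B) E; rewrite !modnMDl !modn_small.
move: E; rewrite u0v0 => /addIn/eqP; rewrite eqn_pmul2r // => /eqP E.
move=> k; case: (unliftP ord0 k) => [k'|] -> //.
by apply: (IHd (fun k => u (lift ord0 k)) (fun k => v (lift ord0 k))).
Qed.

Section PolynomialFunctions.

Variables (R : realType) (d : nat).
Implicit Types (p q : {mpoly R[d]}) (x y a : 'rV[R]_d).

Lemma horner_mmap (h : 'I_d -> {poly R}) p t :
  (mmap polyC h p).[t] = p.@[fun k => (h k).[t]].
Proof.
rewrite mevalE /mmap horner_sum; apply: eq_bigr => m _.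
rewrite hornerM hornerC /mmap1 horner_prod; congr (_ * _).
by apply: eq_bigr => k _; rewrite horner_exp.
Qed.

(** Kronecker substitution: replacing [X_k] by ['X^(B ^ k)], with [B] above all
    the exponents that occur in [p], sends distinct monomials of [p] to
    distinct powers of ['X], so that [p] becomes a univariate polynomial with
    the same coefficients. That polynomial vanishes on all of [R]. *)
Lemma peval_eq0 p : (forall x, peval p x = 0) -> p = 0.
Proof.
move=> p0; pose B := msize p.
have : mmap polyC (fun k : 'I_d => 'X^(B ^ k)) p = 0.
  apply: poly_eq0_fun => t; rewrite horner_mmap.
  rewrite -(p0 (\row_k 'X^(B ^ k).[t])).
  by apply: meval_eq => k; rewrite mxE.
have degB m : m \in msupp p -> forall k, (m k < B)%N.
  move=> mp k; apply: (leq_ltn_trans _ (msize_mdeg_lt mp)).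
  by rewrite mdegE (bigD1 k) //= leq_addr.
rewrite /mmap => E; apply/mpolyP => m; rewrite mcoeff0.
apply/eqP; apply/negPn/negP; rewrite mcoeff_eq0 negbK => mp.
have := congr1 (fun f : {poly R} => f`_(\sum_(k < d) m k * B ^ k)) E.
rewrite coef0 coef_sum (bigD1_seq m) ?msupp_uniq //= => /eqP.
have mmap1E m' : mmap1 (fun k : 'I_d => 'X^(B ^ k)) m' =
    'X^(\sum_(k < d) m' k * B ^ k) :> {poly R}.
  rewrite /mmap1 -prodrXr; apply: eq_bigr => k _.
  by rewrite -exprM mulnC.
rewrite mmap1E coefCM coefXn eqxx mulr1 big1_seq ?addr0.
  by rewrite mcoeff_eq0 mp.
move=> m' /andP[m'm m'p]; rewrite mmap1E coefCM coefXn.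
case: eqP => [/nadic_inj E'|]; last by rewrite mulr0.
case/eqP: m'm; apply/mnmP => k; apply/esym; apply: E' => // k'; exact: degB.
Qed.

(** The univariate polynomial [t |-> p (x + t y)]. *)
Definition on_line x y p : {poly R} :=
  mmap polyC (fun k => (x 0 k)%:P + y 0 k *: 'X) p.

Lemma horner_on_line x y p t : (on_line x y p).[t] = peval p (x + t *: y).
Proof.
rewrite horner_mmap; apply: meval_eq => k.
by rewrite !mxE hornerD hornerC hornerZ hornerX mulrC.
Qed.

Lemma peval_neq0_small p x y s : peval p (x + s *: y) != 0 ->
  for_small (fun t => peval p (x + t *: y) != 0).
Proof.
move=> pxy; have [|e e0 He] := @poly_neq0_small _ (on_line x y p).
  by apply: contraNneq pxy => f0; rewrite -horner_on_line f0 horner0.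
by exists e => // t /He; rewrite horner_on_line.
Qed.

Lemma peval_gt0_small p x y : 0 < peval p x ->
  for_small (fun t => 0 < peval p (x + t *: y)).
Proof.
move=> px; have [|e e0 He] := @poly_gt0_small _ (on_line x y p).
  by rewrite horner_on_line scale0r addr0.
by exists e => // t /He; rewrite horner_on_line.
Qed.

(** Adding the multiple [L / a_k0] of [L = beta - a . X] to the variable
    [X_k0] gives a substitution [h] whose values all lie on the hyperplane.
    So [p] composed with [h] is zero as a function, hence as a polynomial, and
    [p = p - p o h] is a multiple of [L] because [X_k - h_k] is one for
    every [k]. *)
Lemma factor_of_hyperplane a (beta : R) p :
  a != 0 -> (forall x, dot a x = beta -> peval p x = 0) ->
  is_factor (facet_poly a beta) p.
Proof.
move=> a0 p0; have [k0 ak0] : exists k, a 0 k != 0.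
  apply/existsP; rewrite -negb_forall; apply: contraNN a0 => /forallP ak.
  by apply/eqP/rowP => k; rewrite mxE; apply/eqP.
pose L := facet_poly a beta.
pose h k : {mpoly R[d]} := 'X_k + ((a 0 k0)^-1 *+ (k == k0)) *: L.
have Lev x : peval L x = beta - dot a x.
  rewrite /peval /L /facet_poly mevalB mevalC (raddf_sum (meval _)).
  congr (_ - _).
  by apply: eq_bigr => k _; rewrite /= mevalZ mevalXU.
have {p0} q0 : p \mPo [tuple h k | k < d] = 0.
  apply: peval_eq0 => x; rewrite /peval comp_mpoly_meval.
  pose z : 'rV[R]_d := \row_k (h k).@[fun k => x 0 k].
  rewrite -(p0 z).
    by apply: meval_eq => k; rewrite tnth_mktuple mxE.
  rewrite /dot (eq_bigr (fun k =>
     a 0 k * x 0 k + (beta - dot a x) * (a 0 k * (a 0 k0)^-1 *+ (k == k0)))).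
    rewrite big_split /= -mulr_sumr -/(dot a x).
    rewrite (bigD1 k0) //= eqxx mulr1n divff //.
    rewrite big1 ?addr0 ?mulr1; first by rewrite addrC subrK.
    by move=> k /negPf->; rewrite mulr0n.
  move=> k _; rewrite mxE mevalD mevalXU mevalZ -/(peval L x) Lev.
  rewrite mulrDr; congr (_ + _).
  by case: eqP => _; rewrite ?mulr1n ?mulr0n; ring.
(* The difference is divisible by L for every p, so induct on monomials. *)
suff [r Hr] : exists r, p - (p \mPo [tuple h k | k < d]) = L * r.
  by exists r; rewrite -Hr q0 subr0.
elim/mpolyind: p {q0} => [|c m p _ _ [r Hr]].
  by exists 0; rewrite comp_mpoly0 subr0 mulr0.
suff [s Hs] : exists s, 'X_[m] - ('X_[m] \mPo [tuple h k | k < d]) = L * s.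
  exists (c *: s + r); rewrite comp_mpolyD comp_mpolyZ mulrDr -scalerAr -Hs -Hr.
  by rewrite scalerBr opprD addrACA.
rewrite comp_mpolyX mpolyXE_id.
apply: (big_ind2 (fun u v => exists s, u - v = L * s)).
- by exists 0; rewrite subrr mulr0.
- move=> u u' v v' [s Hs] [s' Hs'].
  exists (s * v + u' * s').
  by rewrite mulrDr mulrA -Hs [L * (_ * _)]mulrCA -Hs'; ring.
move=> k _; rewrite tnth_mktuple.
have Xh : 'X_k - h k = L * - ((a 0 k0)^-1 *+ (k == k0))%:MP.
  by rewrite /h opprD addrA subrr add0r mulrN mulrC mul_mpolyC.
rewrite subrXX Xh -mulrA; eexists; reflexivity.
Qed.

End PolynomialFunctions.

(** * Faces and their active constraints *)

Lemma exists_minimizer (T : Type) (Q : T -> Prop) (f : T -> nat) :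
  (exists x, Q x) -> exists2 x, Q x & forall y, Q y -> (f x <= f y)%N.
Proof.
move=> [x0 Qx0]; pose A n := `[< exists2 x, Q x & f x = n >].
have exA : exists n, A n by exists (f x0); apply/asboolP; exists x0.
case: (ex_minnP exA) => n /asboolP[x Qx <-] min_x.
by exists x => // y Qy; apply: min_x; apply/asboolP; exists y.
Qed.

Section Faces.

Variables (R : realType) (d : nat).
Implicit Types (a c x y v : 'rV[R]_d) (S F : set 'rV[R]_d).

Lemma dotD a x y : dot a (x + y) = dot a x + dot a y.
Proof. by rewrite -big_split; apply: eq_bigr => k _; rewrite mxE mulrDr. Qed.

Lemma dotZ a t x : dot a (t *: x) = t * dot a x.
Proof. by rewrite mulr_sumr; apply: eq_bigr => k _; rewrite mxE mulrCA. Qed.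

Lemma dotB a x y : dot a (x - y) = dot a x - dot a y.
Proof. by rewrite dotD -scaleN1r dotZ mulN1r. Qed.

Lemma dot0r a : dot a 0 = 0.
Proof. by rewrite -(subrr 0) dotB subrr. Qed.

Lemma dot0l x : dot 0 x = 0.
Proof. by rewrite /dot big1 // => k _; rewrite mxE mul0r. Qed.

Lemma dot_sum a n (u : 'I_n -> 'rV[R]_d) :
  dot a (\sum_s u s) = \sum_s dot a (u s).
Proof. exact: (big_morph (dot a) (dotD a) (dot0r a)). Qed.

Definition dotE := (dotB, dotD, dotZ, dot0r).

Lemma dot_mulmx a x : (x *m a^T) 0 0 = dot a x.
Proof. by rewrite mxE; apply: eq_bigr => k _; rewrite mxE mulrC. Qed.

Lemma sub_aff_hull S : S `<=` aff_hull S.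
Proof.
move=> x Sx; exists 1%N, (fun=> 1), (fun=> x).
by split=> //; rewrite big_ord1 ?scale1r.
Qed.

Lemma aff_hull_dot S a beta x :
  (forall y, S y -> dot a y = beta) -> aff_hull S x -> dot a x = beta.
Proof.
move=> Sa [n [c [v [Sv c1 ->]]]]; rewrite dot_sum -[RHS]mul1r -c1 mulr_suml.
by apply: eq_bigr => s _; rewrite dotZ Sa.
Qed.

Lemma aff_hull_line S x y t :
  t != 0 -> S x -> S (x + t *: (y - x)) -> aff_hull S y.
Proof.
move=> t0 Sx Sxy; exists 2%N, (fun s => if s == ord0 then 1 - t^-1 else t^-1).
exists (fun s => if s == ord0 then x else x + t *: (y - x)); split.
- by move=> s; case: ifP.
- by rewrite big_ord_recl big_ord1 /= subrK.
rewrite big_ord_recl big_ord1 /= scalerDr scalerA mulVf // scale1r.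
by rewrite scalerBl scale1r addrA addrNK addrC subrK.
Qed.

Lemma has_dim_nonempty S k : has_dim S k -> exists x, S x.
Proof.
move=> [x0 [U [_ E]]]; have : aff_hull S x0 by rewrite E /= subrr mem0v.
move=> [[|n] [c [v [Sv c1 _]]]]; last by exists (v ord0).
by move: c1; rewrite big_ord0 => /eqP; rewrite eq_sym oner_eq0.
Qed.

Variables (m : nat) (a : 'I_m -> 'rV[R]_d) (b : 'I_m -> R).
Implicit Types (i : 'I_m) (I : {set 'I_m}).

Local Notation P := (polyhedron a b).

Lemma dim_rV_le (U : {vspace 'rV[R]_d}) : (\dim U <= d)%N.
Proof. by have := dimvS (subvf U); rewrite dimvf /dim /= mul1n. Qed.

Lemma dim_rV_full (U : {vspace 'rV[R]_d}) : \dim U = d -> U = fullv.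
Proof.
move=> dimU; apply/eqP; rewrite -dimv_leqif_eq ?subvf // dimU.
by rewrite dimvf /dim /= mul1n.
Qed.

Definition active v : {set 'I_m} := finset (fun i => dot (a i) v == b i).

Lemma activeP v i : reflect (dot (a i) v = b i) (i \in active v).
Proof. by rewrite inE; apply: eqP. Qed.

Lemma slack v i : P v -> i \notin active v -> dot (a i) v < b i.
Proof. by move=> Pv; rewrite inE lt_def eq_sym Pv andbT. Qed.

(** When [v] lies in [P] and [I = active v], this turns out to be the affine
    hull of the smallest face of [P] through [v]. *)
Definition flat I : set 'rV[R]_d :=
  [set x | forall i, i \in I -> dot (a i) x = b i].

Definition flat_dir I : {vspace 'rV[R]_d} :=
  (\bigcap_(i in I) lker (linfun (mulmxr (a i)^T)))%VS.

Lemma flat_dirP I y :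
  reflect (forall i, i \in I -> dot (a i) y = 0) (y \in flat_dir I).
Proof.
rewrite memvE /flat_dir; apply: (iffP subv_bigcapP) => H i /H.
  rewrite -memvE memv_ker lfunE /= => /eqP E.
  by rewrite -dot_mulmx E mxE.
move=> E; rewrite -memvE memv_ker lfunE /=; apply/eqP/matrixP => r s.
by rewrite !ord1 dot_mulmx E mxE.
Qed.

Lemma flat_active v : flat (active v) v.
Proof. by move=> i /activeP. Qed.

Lemma flat_sub I I' : I' \subset I -> flat I `<=` flat I'.
Proof. by move=> /fintype.subsetP sI x xI i /sI/xI. Qed.

Lemma flat_line I x y t : flat I x -> flat I y -> flat I (x + t *: (y - x)).
Proof. by move=> xI yI i iI; rewrite !dotE xI // yI //; ring. Qed.

Lemma flat_dirB I x y : flat I x -> flat I y -> x - y \in flat_dir I.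
Proof. by move=> xI yI; apply/flat_dirP => i iI; rewrite dotB xI ?yI ?subrr. Qed.

Lemma dim_flat S I k x :
  flat I x -> aff_hull S = flat I -> has_dim S k -> \dim (flat_dir I) = k.
Proof.
move=> xI SI [x0 [U [<- SU]]]; congr (\dim _).
have IU y : flat I y <-> y - x0 \in U by rewrite -SI SU.
apply/vspaceP => y; have -> : (y \in U) = (x + y - x0 \in U).
  by rewrite [x + y]addrC -addrA rpredDr //; apply/IU.
apply/flat_dirP/idP => [yI|/IU yI i iI].
  by apply/IU => i iI; rewrite dotD xI // yI // addr0.
by have := yI i iI; rewrite dotD xI // => E; lra.
Qed.

(** Along a direction allowed by the active constraints, the others stay
    slack for a while. *)
Lemma active_small v y :
  P v -> (forall i, i \in active v -> dot (a i) y <= 0) ->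
  for_small (fun t => P (v + t *: y) /\
    active (v + t *: y) =
      finset (fun i => (i \in active v) && (dot (a i) y == 0))).
Proof.
move=> Pv yv; pose Q i t := dot (a i) (v + t *: y) <= b i /\
  (i \in active (v + t *: y)) = (i \in active v) && (dot (a i) y == 0).
suff [e e0 He] : for_small (fun t => forall i, Q i t).
  exists e => // t /He Qt; split=> [i|]; first by have [] := Qt i.
  by apply/finset.setP => i; have [_ ->] := Qt i; rewrite [RHS]finset.in_set.
apply: for_small_all => i; rewrite /Q.
have [iv|iv] := boolP (i \in active v).
  exists 1 => // t /andP[t0 _]; have /activeP ivE := iv.
  rewrite inE !dotE ivE; split; first by rewrite gerDl pmulr_rle0 // yv.
  by rewrite -subr_eq0 addrAC subrr add0r mulf_eq0 gt_eqF.
have lt_iv := slack Pv iv.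
have [|e e0 He] :=
    @poly_gt0_small _ ((b i - dot (a i) v)%:P - dot (a i) y *: 'X).
  by rewrite hornerD hornerN hornerZ hornerX hornerC mulr0 subr0 subr_gt0.
exists e => // t /He; rewrite hornerD hornerN hornerZ hornerX hornerC => ht.
have lt_b : dot (a i) (v + t *: y) < b i by rewrite !dotE; lra.
by rewrite ltW //; split=> //; rewrite inE lt_eqF.
Qed.

Lemma polyhedron_small v y :
  P v -> y \in flat_dir (active v) -> for_small (fun t => P (v + t *: y)).
Proof.
move=> Pv /flat_dirP yv.
have [|e e0 He] := active_small Pv (y := y); first by move=> i /yv->.
by exists e => // t /He[].
Qed.

(** A point [v] of [F] with as few active constraints as possible lies in the
    relative interior of [F]: a constraint active at [v] but not at another
    point [x] of [F] would be inactive at the midpoint of [v] and [x]. So [F]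
    lies in the flat of [v]. Conversely, all points of this flat close to [v]
    are in [P]; as the linear form defining [F] attains its maximum at [v], it
    is constant on the flat, and these points are in [F]. *)
Lemma face_flat F : is_face P F -> (exists x, F x) ->
  exists2 v, F v & aff_hull F = flat (active v).
Proof.
move=> [c [delta [cP FE]]] F0.
have FP x : F x -> P x by rewrite FE => -[].
have [v Fv min_v] := exists_minimizer (fun v => #|active v|) F0.
have Fdelta x : F x -> dot c x = delta by rewrite FE => -[].
have F_active x : F x -> flat (active v) x.
  move=> Fx i iv; apply/eqP; apply/negPn/negP => ix.
  pose z := v + 2^-1 *: (x - v).
  have zE a0 : dot a0 z = (dot a0 v + dot a0 x) / 2.
    by rewrite /z !dotE; field.
  have Fz : F z.
    rewrite FE; split=> [j|]; rewrite /= zE ?Fdelta //; last by field.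
    by have := FP v Fv j; have := FP x Fx j; lra.
  suff /proper_card : active z \proper active v by rewrite ltnNge min_v.
  apply/properP; split; last first.
    exists i => //; apply: contra ix => /activeP; rewrite zE.
    by move/activeP: iv => -> ?; apply/eqP; lra.
  apply/fintype.subsetP => j /activeP; rewrite zE => ?; apply/activeP.
  by have := FP v Fv j; have := FP x Fx j; lra.
exists v => //; apply/seteqP; split=> [x Fx i iv|y yv].
  by apply: aff_hull_dot Fx => z Fz; apply: F_active.
have small1 := polyhedron_small (FP v Fv) (flat_dirB yv (@flat_active v)).
have small2 := polyhedron_small (FP v Fv) (flat_dirB (@flat_active v) yv).
have [t t0 [P1 P2]] := for_small_ex (for_small_and small1 small2).
apply: (@aff_hull_line _ v y t); rewrite ?gt_eqF //.
rewrite FE; split=> //=; rewrite !dotE Fdelta //.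
have := cP _ P1; have := cP _ P2; rewrite !dotE (Fdelta v Fv).
by move=> ? ?; nra.
Qed.

(** If every point of [P] had an active constraint, then at a point of [P] with
    as few of them as possible that constraint would be constant on [P], and
    its facet would be [P] itself, which has the wrong dimension. *)
Lemma exists_interior : has_dim P d -> irredundant a b ->
  exists2 w, P w & active w = finset.set0.
Proof.
move=> dimP [facets _].
have faceP : is_face P P.
  exists 0, 0; split=> [x _|]; first by rewrite dot0l.
  by apply/seteqP; split=> [x Px|x []//]; split=> //=; rewrite dot0l.
have [w Pw affP] := face_flat faceP (has_dim_nonempty dimP).
exists w => //; apply/finset.setP => i; rewrite finset.in_set0.
apply/negP => iw.
have dimw := dim_flat (@flat_active w) affP dimP.
have dir_full y : y \in flat_dir (active w) by rewrite (dim_rV_full dimw) memvf.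
have [_ [k kd dimFi]] := facets i.
have PE : P `&` [set x | dot (a i) x = b i] = P.
  apply/seteqP; split=> [x []//|x Px]; split=> //=.
  have /flat_dirP/(_ i iw) := dir_full (x - w).
  by move/activeP: iw; rewrite dotB => <- /eqP; rewrite subr_eq0 => /eqP.
rewrite PE in dimFi; have := dim_flat (@flat_active w) affP dimFi.
by rewrite dimw -kd => /eqP; rewrite eqn_leq ltnn.
Qed.

(** In terms of faces: a proper face of [P] lies in a face whose dimension is
    at most one more. Among the points of [P] with fewer active constraints
    than [v] choose [x] with as many as possible. Were there a direction [y]
    along the flat of [x] but outside the span of the flat of [v] and
    [x - v], one could move from [x] along [y] up to the first hyperplane of a
    constraint active at [v]; this may leave [P] through some other
    constraint, but after shrinking towards [v] the point is in [P] again, and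
    it has more active constraints than [x]. *)
Lemma next_face v w : P v -> P w -> active w \proper active v ->
  exists x, [/\ P x, active x \proper active v &
    (\dim (flat_dir (active x)) <= (\dim (flat_dir (active v))).+1)%N].
Proof.
move=> Pv Pw wv.
have ex0 : exists x, P x /\ active x \proper active v by exists w.
have [x [Px xv] max_x] := exists_minimizer (fun x => #|~: active x|) ex0.
have sxv := proper_sub xv.
exists x; split => //.
suff /dimvS le_dim :
    (flat_dir (active x) <= flat_dir (active v) + <[x - v]>)%VS.
  apply: leq_trans le_dim _; apply: leq_trans (dimv_add_leqif _ _) _.
  by rewrite dim_vline; case: (_ != _); rewrite ?addn1 ?addn0.
apply/subvP => y yx; apply/negPn/negP => yv.
(* Up to sign, y moves towards some constraint that is active at v. *)
wlog [i iv ay] : y yx yv / exists2 i, i \in active v & 0 < dot (a i) y.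
  move=> wlog_y; have : y \notin flat_dir (active v).
    by apply: contra yv => /(subvP (addvSl _ _)).
  move/flat_dirP/existsNP => [i /not_implyP[iv /eqP]].
  rewrite neq_lt => /orP[ay|ay]; last by apply: (wlog_y y) => //; exists i.
  apply: (wlog_y (- y)); rewrite ?rpredN //; exists i => //.
  by rewrite -sub0r dotB dot0r sub0r oppr_gt0.
(* t is the first time at which x + t y meets such a constraint, and z is
   x + t y shrunk towards v. *)
pose ratio j := (b j - dot (a j) x) / dot (a j) y.
pose J j := (j \in active v) && (0 < dot (a j) y).
have iJ : J i by rewrite /J iv.
case: (arg_minP ratio iJ) => i0 /andP[i0v ay0] min_i0.
set t := ratio i0 in min_i0.
have i0x : i0 \notin active x.
  by apply: contraL ay0 => /(flat_dirP _ _ yx)->; rewrite ltxx.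
have t0 : 0 < t.
  by rewrite divr_gt0 // subr_gt0 slack.
pose u := x + t *: y - v.
have uv j : j \in active v -> dot (a j) u = dot (a j) x + t * dot (a j) y - b j.
  by move=> /activeP jv; rewrite /u !dotE jv.
have [||e e0 He] := @active_small v u; first by [].
  move=> j jv; rewrite uv //; have Pxj := Px j.
  have [ayj|ayj] := ltP 0 (dot (a j) y); last by nra.
  have : t <= ratio j by apply: min_i0; rewrite /J jv.
  by rewrite ler_pdivlMr // => ?; lra.
have [s _ [Pz zE]] := for_small_ex (ex_intro2 _ _ e e0 He).
set z := v + s *: u in Pz zE.
have xz : active x \proper active z.
  apply/properP; split.
    apply/fintype.subsetP => j jx; have jv := fintype.subsetP sxv j jx.
    rewrite zE inE jv uv // (flat_dirP _ _ yx) // mulr0 addr0.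
    by rewrite (activeP _ _ jx) subrr /=.
  exists i0 => //; rewrite zE inE i0v uv //.
  have -> : t * dot (a i0) y = b i0 - dot (a i0) x by rewrite divfK ?gt_eqF.
  by rewrite [dot _ _ + _]addrC subrK subrr eqxx.
have zv : active z \proper active v.
  rewrite properE; apply/andP; split.
    by apply/fintype.subsetP => j; rewrite zE inE => /andP[].
  apply: contra yv => /fintype.subsetP vz.
  have uL : u \in flat_dir (active v).
    by apply/flat_dirP => j /vz; rewrite zE inE => /andP[_ /eqP].
  have -> : y = t^-1 *: u + (- t^-1) *: (x - v).
    rewrite scaleNr -scalerBr /u opprB.
    by rewrite addrA addrNK [x + _]addrC addrK scalerA mulVf ?scale1r ?gt_eqF.
  by rewrite memv_add // memvZ // memv_line.
have := max_x z (conj Pz zv); rewrite leqNgt => /negP; apply.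
by apply: proper_card; rewrite finset.properC.
Qed.

(** Finitely many polynomials, none of which vanishes on a flat, do not vanish
    at a common point of it: between a point good for the first and a point
    good for the others, the line has only finitely many bad points. *)
Lemma flat_common_nonzero I (T : eqType) (s : seq T) (q : T -> {mpoly R[d]}) :
  (exists x, flat I x) ->
  (forall j, j \in s -> exists2 x, flat I x & peval (q j) x != 0) ->
  exists2 x, flat I x & forall j, j \in s -> peval (q j) x != 0.
Proof.
move=> I0; elim: s => [|j s IHs] sI.
  by have [x xI] := I0; exists x.
have [|x xI xs] := IHs; first by move=> k ks; apply: sI; rewrite inE ks orbT.
have [y yI yj] := sI j (mem_head j s).
have small_s : for_small (fun t => forall k, k \in s ->
    peval (q k) (y + t *: (x - y)) != 0).
  apply: for_small_seq => k ks; apply: (@peval_neq0_small _ _ _ _ _ 1).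
  by rewrite scale1r addrC subrK xs.
have small_j : for_small (fun t => peval (q j) (y + t *: (x - y)) != 0).
  by apply: (@peval_neq0_small _ _ _ _ _ 0); rewrite scale0r addr0.
have [t _ [tj ts]] := for_small_ex (for_small_and small_j small_s).
exists (y + t *: (x - y)); first exact: flat_line.
by move=> k; rewrite inE => /predU1P[->|/ts].
Qed.

End Faces.

(** * Polynomials vanishing on faces *)

Section Representation.

Variables (R : realType) (d m l : nat).
Variables (a : 'I_m -> 'rV[R]_d) (b : 'I_m -> R) (p : 'I_l -> {mpoly R[d]}).
Hypothesis hp : polyhedron a b = [set x | forall j, 0 <= peval (p j) x].
Implicit Types (v w x y : 'rV[R]_d) (I : {set 'I_m}) (j : 'I_l).

Local Notation P := (polyhedron a b).
Local Notation active := (active a b).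
Local Notation flat := (flat a b).
Local Notation flat_dir := (flat_dir a).

Definition vanishing I : {set 'I_l} :=
  finset (fun j => `[< forall x, flat I x -> peval (p j) x = 0 >]).

Lemma vanishingP I j :
  reflect (forall x, flat I x -> peval (p j) x = 0) (j \in vanishing I).
Proof. by rewrite inE; apply: asboolP. Qed.

Lemma nonvanishingP I j :
  reflect (exists2 x, flat I x & peval (p j) x != 0) (j \notin vanishing I).
Proof.
apply: (iffP negP) => [jI|[x xI /eqP px] /vanishingP/(_ x xI)//].
apply: contrapT => H; apply: jI; apply/vanishingP => x xI.
by apply/eqP; apply/negPn/negP => px; apply: H; exists x.
Qed.

(** Otherwise some point of the flat of [v], close to [v] and hence in [P], is
    not a zero of any [p j] that is not identically zero on the flat of [w].
    There these [p j] are positive, and they stay so after a small step in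
    direction [v - w], while the remaining ones are zero. So the step stays in
    [P], although it violates any constraint that is active at [v] but not at
    [w]. *)
Lemma new_vanishing v w : P v -> P w -> active w \proper active v ->
  vanishing (active w) \proper vanishing (active v).
Proof.
move=> Pv Pw wv; have swv := proper_sub wv; apply/properP; split.
  apply/fintype.subsetP => j /vanishingP jw; apply/vanishingP => x xv.
  by apply: jw; apply: flat_sub xv.
apply: contrapT => noj.
have [z zv pz] : exists2 z, flat (active v) z &
    forall j, j \in enum (~: vanishing (active w)) -> peval (p j) z != 0.
  apply: flat_common_nonzero; first by exists v; apply: flat_active.
  move=> j; rewrite mem_enum finset.in_setC => jw.
  by apply/nonvanishingP/negP => jv; apply: noj; exists j.
have [x [xv Px px]] : exists x, [/\ flat (active v) x, P x &
    forall j, j \notin vanishing (active w) -> 0 < peval (p j) x].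
  have small_p : for_small (fun t => forall j,
      j \in enum (~: vanishing (active w)) ->
      peval (p j) (v + t *: (z - v)) != 0).
    apply: for_small_seq => j /pz pzj; apply: (@peval_neq0_small _ _ _ _ _ 1).
    by rewrite scale1r addrC subrK.
  have small_P := polyhedron_small Pv (flat_dirB zv (@flat_active _ _ _ a b v)).
  have [t _ [tp tP]] := for_small_ex (for_small_and small_p small_P).
  exists (v + t *: (z - v)); split => //.
    by apply: flat_line => //; apply: flat_active.
  move=> j jw; rewrite lt_def tp ?mem_enum ?finset.in_setC //=.
  by move: tP; rewrite hp; apply.
have small_x : for_small (fun t => forall j,
    j \in enum (~: vanishing (active w)) ->
    0 < peval (p j) (x + t *: (v - w))).
  apply: for_small_seq => j; rewrite mem_enum finset.in_setC => jw.
  exact: peval_gt0_small (px j jw).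
have [t t0 tx] := for_small_ex small_x.
have : P (x + t *: (v - w)).
  rewrite hp => j; have [jw|jw] := boolP (j \in vanishing (active w)); last first.
    by apply: ltW; apply: tx; rewrite mem_enum finset.in_setC.
  move/vanishingP: jw => -> // i iw; rewrite !dotE.
  rewrite (flat_sub swv xv) // (flat_sub swv (@flat_active _ _ _ a b v)) //.
  by move/activeP: iw => ->; rewrite subrr mulr0 addr0.
have /properP[_ [i iv iw]] := wv; move/(_ i).
rewrite !dotE xv // (activeP _ _ _ _ iv).
by have := slack Pw iw => ? ?; nra.
Qed.

(** Climb from [v] to larger and larger faces by [next_face]; each step raises
    the dimension by at most one and loses a vanishing polynomial. *)
Lemma card_vanishing w v : P w -> active w = finset.set0 -> P v ->
  (d <= \dim (flat_dir (active v)) + #|vanishing (active v)|)%N.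
Proof.
move=> Pw w0; have [n] := ubnP #|active v|; elim: n v => // n IHn v + Pv.
have [v0 _|v0] := eqVneq (active v) finset.set0.
  by rewrite v0 /flat_dir big_set0 dimvf /dim /= mul1n leq_addr.
rewrite ltnS => vn.
have [|x [Px xv dimx]] := next_face Pv Pw; first by rewrite w0 proper0.
have {}IHn := IHn x (leq_trans (proper_card xv) vn) Px.
have := proper_card (new_vanishing Pv Px xv); lia.
Qed.

(** The flat of a relative interior point [v] of the facet is contained in the
    hyperplane [a_i . x = b_i], which has no larger dimension because the
    interior point [w] shows that [a_i] is nonzero. *)
Lemma facet_flat w i k : P w -> active w = finset.set0 ->
  is_face P (P `&` [set x | dot (a i) x = b i]) ->
  has_dim (P `&` [set x | dot (a i) x = b i]) k -> k.+1 = d ->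
  exists v, [/\ P v, i \in active v &
    forall x, dot (a i) x = b i -> flat (active v) x].
Proof.
move=> Pw w0 face dimF kd.
have [v [Pv vi] affF] := face_flat face (has_dim_nonempty dimF).
have iv : i \in active v by apply/activeP.
have iw : i \notin active w by rewrite w0 inE.
exists v; split => // x xi.
have dimv := dim_flat (@flat_active _ _ _ a b v) affF dimF.
suff /eqP E : flat_dir (active v) == flat_dir [set i]%SET.
  have : x - v \in flat_dir (active v).
    rewrite E; apply/flat_dirP => j; rewrite inE => /eqP ->.
    by rewrite dotB xi vi subrr.
  move=> /flat_dirP xv j jv; have := xv j jv; rewrite dotB.
  by move/activeP: jv => -> /eqP; rewrite subr_eq0 => /eqP.
rewrite eqEdim; apply/andP; split.
  apply/subvP => y /flat_dirP yv; apply/flat_dirP => j.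
  by rewrite inE => /eqP ->; apply: yv.
rewrite dimv -ltnS kd ltn_neqAle dim_rV_le andbT.
apply/negP => /eqP/dim_rV_full E.
have /flat_dirP/(_ i) : w - v \in flat_dir [set i]%SET by rewrite E memvf.
rewrite inE eqxx dotB vi => /(_ isT)/eqP; rewrite subr_eq0 => wi.
by case/negP: iw; rewrite inE.
Qed.

End Representation.

Theorem proposition2p1 (R : realType) (d m l : nat)
    (a : 'I_m -> 'rV[R]_d) (b : 'I_m -> R) (p : 'I_l -> {mpoly R[d]})
    (hdim : has_dim (polyhedron a b) d)
    (hirr : irredundant a b)
    (hp : polyhedron a b = [set x | forall j, 0 <= peval (p j) x]) :
  (forall i : 'I_m, exists j : 'I_l, is_factor (facet_poly (a i) (b i)) (p j))
  /\
  (forall (F : set 'rV[R]_d) (k : nat),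
     is_face (polyhedron a b) F -> has_dim F k ->
     exists j : 'I_(d - k) -> 'I_l,
       injective j /\
       aff_hull F `<=` [set x | forall s, peval (p (j s)) x = 0]).
Proof.
have [w Pw w0] := exists_interior hdim hirr.
split=> [i|F k faceF dimF].
  have [face [k kd dimF]] := hirr.1 i.
  have [v [Pv iv vi]] := facet_flat Pw w0 face dimF kd.
  have wv : active a b w \proper active a b v.
    by rewrite w0 proper0; apply/finset.set0Pn; exists i.
  have /properP[_ [j /vanishingP jv _]] := new_vanishing hp Pv Pw wv.
  exists j; apply: factor_of_hyperplane => [|x /vi]; last exact: jv.
  apply/eqP => ai0; have /activeP := iv; rewrite ai0 dot0l => bi.
  have : i \in active a b w by apply/activeP; rewrite ai0 dot0l.
  by rewrite w0 inE.
have [v Fv affF] := face_flat faceF (has_dim_nonempty dimF).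
have Pv : polyhedron a b v.
  by have [c [delta [_ FE]]] := faceF; move: Fv; rewrite FE => -[].
have := card_vanishing hp Pw w0 Pv.
rewrite (dim_flat (@flat_active _ _ _ a b v) affF dimF).
rewrite -leq_subLR => le_card.
exists (fun s => enum_val (widen_ord le_card s)); split.
  by move=> s s' /enum_val_inj/(congr1 val) ss'; apply: val_inj.
move=> x; rewrite affF => xv s.
by have /vanishingP := enum_valP (widen_ord le_card s); apply.
Qed.
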